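(* There is an absolute constant $c>0$ such that the following holds. Let $\varepsilon\in(0,1)$ and $n\in\mathbb N$. For any linear space $Q_m\subset L_1[0,1]$ of dimension $m\le(1-\varepsilon)n$ we have $$\frac1n\sum_{k=1}^n\rho(r_k,Q_m)_{L_1[0,1]}\ge c\varepsilon^2.$$
   Context: $\{r_k\}_{k\ge1}$ is the Rademacher system on $[0,1]$, defined in terms of binary expansions: $r_k\left(\sum_{j\ge1}2^{-j}x_j\right)=(-1)^{x_k}$, $x_j\in\{0,1\}$ (defined almost everywhere). For a subset $Q$ of a normed space $X$, $\rho(x,Q)_X:=\inf_{y\in Q}\|x-y\|_X$. *)

(* Defs.v *)
From HB Require Import structures.
From mathcomp Require Import all_boot all_order all_algebra.
From mathcomp Require Import all_classical all_reals all_analysis.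
From mathcomp Require Import measurable_realfun.

Set Implicit Arguments.
Unset Strict Implicit.
Unset Printing Implicit Defensive.
Import Order.TTheory GRing.Theory Num.Theory.
Import numFieldNormedType.Exports.
Local Open Scope classical_set_scope.
Local Open Scope ring_scope.
Local Open Scope quotient_scope.

(* The library's [LspaceType mu p1] carries no algebraic structure and
   [LfunType mu p1] is a module of functions (not of classes), so the normed
   space L_1(mu) is built here as the quotient of the module of integrable
   functions by the submodule of functions vanishing almost everywhere. *)
Section L1space.
Context d (T : measurableType d) (R : realType).
Variable mu : {measure set T -> \bar R}.

Local Notation L1fun := (LfunType mu (@lexx _ (\bar R) 1%E)).

Definition L1null : {pred L1fun} :=
  fun f => `[< (f : T -> R) = cst 0 %[ae mu] >].

Lemma L1nullP (f : L1fun) :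
  reflect ((f : T -> R) = cst 0 %[ae mu]) (f \in L1null).
Proof. exact: asboolP. Qed.

Lemma L1null_submod_closed : submod_closed L1null.
Proof.
split; first by apply/L1nullP; exact: aeW.
move=> a f g /L1nullP f0 /L1nullP g0; apply/L1nullP.
move: f0 g0; apply: filterS2 => x /= f0 g0 _.
transitivity (a * f x + g x) => //.
by rewrite f0// g0//= mulr0 addr0.
Qed.

HB.instance Definition _ := GRing.isSubmodClosed.Build _ _ L1null
  L1null_submod_closed.

Definition L1space := Quotient.quot L1null.
HB.instance Definition _ := Choice.on L1space.
HB.instance Definition _ := EqQuotient.on L1space.
HB.instance Definition _ := GRing.Zmodule.on L1space.

Lemma L1spaceE (f g : L1fun) :
  (\pi_L1space f = \pi_L1space g) <-> ((f : T -> R) = g %[ae mu]).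
Proof.
split.
  move=> /eqP; rewrite -Quotient.idealrBE => /L1nullP.
  apply: filterS => x /= /[apply] /= /eqP.
  by rewrite subr_eq0 => /eqP.
move=> fg; apply/eqP; rewrite -Quotient.idealrBE; apply/L1nullP.
move: fg; apply: filterS => x /= /[apply] /= fg.
by apply/eqP; rewrite subr_eq0 fg.
Qed.

Lemma L1space_piD (f g : L1fun) :
  \pi_L1space (f + g) = \pi_L1space f + \pi_L1space g.
Proof. exact: (Quotient.pi_add L1null f g). Qed.

Lemma L1space_pi0 : \pi_L1space (0 : L1fun) = 0.
Proof.
by apply: (addrI (\pi_L1space (0 : L1fun))); rewrite -L1space_piD !addr0.
Qed.

Definition L1scale (a : R) (u : L1space) : L1space :=
  \pi_L1space (a *: (repr u : L1fun)).

Lemma L1space_piZ a (f : L1fun) :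
  L1scale a (\pi_L1space f) = \pi_L1space (a *: f).
Proof.
apply/eqP; rewrite -Quotient.idealrBE -scalerBr rpredZ//.
by rewrite Quotient.idealrBE reprK; exact/eqP.
Qed.

Lemma L1scaleA a b u : L1scale a (L1scale b u) = L1scale (a * b) u.
Proof.
rewrite -[u]reprK (L1space_piZ b) (L1space_piZ a) (L1space_piZ (a * b)).
by rewrite scalerA.
Qed.
Lemma L1scale1 : left_id 1 L1scale.
Proof. by move=> u; rewrite -[u]reprK L1space_piZ scale1r. Qed.
Lemma L1scaleDr : right_distributive L1scale +%R.
Proof.
move=> a u v; rewrite -[u]reprK -[v]reprK -L1space_piD !L1space_piZ.
by rewrite -L1space_piD scalerDr.
Qed.
Lemma L1scaleDl u : {morph L1scale^~ u : a b / a + b}.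
Proof.
by move=> a b; rewrite -[u]reprK !L1space_piZ -L1space_piD scalerDl.
Qed.

HB.instance Definition _ := GRing.Zmodule_isLmodule.Build R L1space
  L1scaleA L1scale1 L1scaleDr L1scaleDl.

Definition L1norm (u : L1space) : R := fine 'N[mu]_1[EFin \o (repr u : L1fun)].

Lemma L1norm_pi (f : L1fun) : L1norm (\pi_L1space f) = fine 'N[mu]_1[EFin \o f].
Proof.
have /L1spaceE fE : \pi_L1space (repr (\pi_L1space f)) = \pi_L1space f.
  exact: reprK.
have mabs (g : L1fun) : measurable_fun [set: T] (abse \o (EFin \o g)).
  by apply: (measurableT_comp (@abse_measurable R setT)); exact/measurable_EFinP.
congr fine; rewrite !Lnorm1; apply: ae_eq_integral; [by []|exact: mabs|exact: mabs|].
by move: fE; apply: filterS => x /= + xT => /(_ xT) ->.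
Qed.

Lemma ler_L1normD u v : L1norm (u + v) <= L1norm u + L1norm v.
Proof.
by rewrite -[u]reprK -[v]reprK -L1space_piD !L1norm_pi; exact: ler_LnormD.
Qed.

Lemma L1normZ a u : L1norm (L1scale a u) = `|a| * L1norm u.
Proof.
rewrite -[u]reprK L1space_piZ !L1norm_pi.
apply: EFin_inj; rewrite EFinM !finite_norm_fine.
exact: LnormZ.
Qed.

Lemma L1norm0_eq0 u : L1norm u = 0 -> u = 0.
Proof.
move=> /fine_Lnormr_eq0 u0; rewrite -L1space_pi0 -[u]reprK.
exact/L1spaceE.
Qed.

HB.instance Definition _ := Lmodule_isNormed.Build R L1space
  ler_L1normD L1normZ L1norm0_eq0.

End L1space.
Arguments L1space {d T R} mu.

Section distance.
Context (R : realType) (X : normedModType R).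

(* [inf] is the genuine infimum when [Q] is nonempty, and is 0 otherwise. *)
Definition dist_to_set (x : X) (Q : set X) : R := inf [set `|x - y| | y in Q].

Definition subspace_of_dim (Q : {pred X}) (m : nat) : Prop :=
  submod_closed Q /\
  exists e : 'I_m -> X,
    [/\ forall i, e i \in Q,
        forall a : 'I_m -> R, \sum_i a i *: e i = 0 -> forall i, a i = 0
      & forall x, x \in Q -> exists a : 'I_m -> R, x = \sum_i a i *: e i].

End distance.

Section rademacher.
Context (R : realType).

(* Lebesgue measure on [0,1], as a measure on the Borel sets of the line
   supported by [0,1]; its L_1 space is L_1[0,1], since functions are
   identified as soon as they agree almost everywhere on [0,1]. *)
Definition lebesgue01 :=
  mrestr (@lebesgue_measure R) (measurable_itv `[0%R, 1%R]).
HB.instance Definition _ := Measure.on lebesgue01.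

(* The [k]-th binary digit of [x] after the point ([1 <= k], [0 <= x < 1]). At
   dyadic rationals this selects the terminating expansion; see
   [rademacher_ae] for the agreement with arbitrary expansions. *)
Definition binary_digit (k : nat) (x : R) : nat := odd (Num.truncn (2 ^+ k * x)).

Definition rademacher_fun (k : nat) (x : R) : R := (-1) ^+ binary_digit k x.

Lemma rademacher_funE k :
  rademacher_fun k = fun x => if x \in \bigcup_(i in [set i | odd i])
     [set` `[i%:R / 2 ^+ k, i.+1%:R / 2 ^+ k[%R] then -1 else 1.
Proof.
have k0 : 0 < 2 ^+ k :> R by rewrite exprn_gt0.
apply/funext => x; rewrite /rademacher_fun /binary_digit.
case: ifPn => [/set_mem[i /= oi]|].
  rewrite in_itv/= ler_pdivrMr// ltr_pdivlMr// (mulrC x) => /truncn_def ->.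
  by rewrite oi expr1.
move=> /negP xi; case: (boolP (odd _)) => // o; exfalso; apply: xi.
apply/mem_set; exists (Num.truncn (2 ^+ k * x)) => //=.
have x0 : 0 <= 2 ^+ k * x.
  rewrite leNgt; apply/negP => x0; move: o.
  by rewrite truncn_floor leNgt x0.
rewrite in_itv/= ler_pdivrMr// ltr_pdivlMr// (mulrC x).
by rewrite truncn_itv.
Qed.

Lemma measurable_rademacher k : measurable_fun [set: R] (rademacher_fun k).
Proof.
rewrite rademacher_funE; apply: measurable_fun_if => //.
apply: (measurable_fun_bool true) => /=.
rewrite setTI (_ : _ @^-1` _ = \bigcup_(i in [set i | odd i])
     [set` `[i%:R / 2 ^+ k, i.+1%:R / 2 ^+ k[%R]).
  by apply: bigcup_measurable => i _; exact: measurable_itv.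
by apply/seteqP; split => x /=; [exact: set_mem|exact: mem_set].
Qed.

Lemma rademacher_norm k x : `|rademacher_fun k x| = 1.
Proof. by rewrite normrX normrN1 expr1n. Qed.

Lemma lebesgue01T : lebesgue01 setT = 1%E.
Proof.
rewrite /lebesgue01/= /mrestr setTI lebesgue_measure_itv/= lte_fin ltr01.
by rewrite oppr0 adde0.
Qed.

Lemma rademacher_finite_norm k : finite_norm lebesgue01 1%E (rademacher_fun k).
Proof.
rewrite /finite_norm Lnorm1.
under eq_integral do rewrite /= rademacher_norm.
by rewrite integral_cst//= mul1e lebesgue01T ltry.
Qed.

Lemma rademacher_Lfun k : rademacher_fun k \in Lfun lebesgue01 1%E.
Proof.
rewrite inE; apply/andP; split; rewrite inE/=.
  exact: measurable_rademacher.
exact: rademacher_finite_norm.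
Qed.

Definition rademacher (k : nat) : L1space lebesgue01 :=
  \pi_(L1space lebesgue01) (Lfun_Sub (lexx 1%E) (rademacher_Lfun k)).

Definition binary_expansion (x : R) (b : nat -> bool) : Prop :=
  \sum_(1 <= j < N.+1) 2 ^- j * (b j)%:R @[N --> \oo] --> x.

Lemma rademacher_fun_binary k x b : (0 < k)%N ->
  binary_expansion x b -> (forall i : nat, 2 ^+ k * x != i%:R) ->
  rademacher_fun k x = (-1) ^+ b k.
Proof.
move=> k0 xb ndx.
have h0 n : 0 < 2 ^+ n :> R by rewrite exprn_gt0.
pose S N : R := \sum_(1 <= j < N.+1) 2 ^- j * (b j)%:R.
pose m := fix m N : nat := if N is N'.+1 then ((m N').*2 + b N)%N else 0%N.
have SS N : S N.+1 = S N + 2 ^- N.+1 * (b N.+1)%:R by rewrite /S big_nat_recr.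
have hm N : 2 ^+ N * S N = (m N)%:R.
  elim: N => [|N IH]; first by rewrite /S big_geq// mulr0.
  rewrite SS mulrDr mulrA divff ?gt_eqF// mul1r exprS -mulrA IH /= natrD.
  by rewrite -mul2n natrM.
have Snd N : S k <= S (k + N)%N.
  elim: N => [|N IH]; first by rewrite addn0.
  by rewrite addnS SS (le_trans IH)// lerDl mulr_ge0// invr_ge0 ltW.
have Sni N : S (k + N)%N + 2 ^- (k + N) <= S k + 2 ^- k.
  elim: N => [|N IH]; first by rewrite addn0.
  apply: le_trans IH; rewrite addnS SS -addrA lerD2l.
  rewrite [leRHS](_ : _ = 2 ^- (k + N).+1 + 2 ^- (k + N).+1).
    rewrite lerD2r ler_piMr ?invr_ge0 ?(ltW (h0 _))//.
    by case: (b _); rewrite ?ler01.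
  by rewrite exprS invfM (mulrC 2^-1) -splitr.
have xlim : S (N + k)%N @[N --> \oo] --> x by rewrite (cvg_shiftn k S).
have lex : S k <= x.
  apply: (cvgr_to_ge xlim); apply: nearW => N; rewrite addnC; exact: Snd.
have gex : x <= S k + 2 ^- k.
  apply: (cvgr_to_le xlim); apply: nearW => N; rewrite addnC.
  by apply: le_trans (Sni N); rewrite lerDl invr_ge0 ltW.
rewrite /rademacher_fun /binary_digit (@truncn_def _ _ (m k)).
  by case: (k) k0 => // j _ /=; rewrite oddD odd_double; case: (b _).
rewrite -hm ler_pM2l// lex/= lt_neqAle (ndx (m k).+1)/=.
rewrite -(natr1 (m k)) -hm; apply: (le_trans (_ : _ <= 2 ^+ k * (S k + 2 ^- k))).
  by rewrite ler_pM2l.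
by rewrite mulrDr divff ?gt_eqF.
Qed.

Lemma rademacher_ae k : (0 < k)%N ->
  {ae lebesgue01, forall x b, binary_expansion x b ->
     rademacher_fun k x = (-1) ^+ b k}.
Proof.
move=> k0; have h0 : 2 ^+ k != 0 :> R by rewrite expf_neq0.
pose D := range (fun i : nat => i%:R / 2 ^+ k : R).
have cD : countable D by exact: card_image_le.
have mD : measurable D by exact: countable_measurable.
exists D; split => //.
  apply/eqP; rewrite eq_le measure_ge0 andbT /lebesgue01 /mrestr.
  rewrite -(countable_lebesgue_measure0 cD) le_measure ?inE//.
  exact: measurableI.
move=> x /=; apply: contra_notP => nDx b xb.
apply: rademacher_fun_binary => // i; apply/eqP => xi; apply: nDx.
by exists i => //; rewrite -xi mulrAC divff// mul1r.
Qed.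

End rademacher.
Arguments lebesgue01 R X : clear implicits.

(* Main.v *)
Require Import Defs.
From mathcomp Require Import all_boot all_order all_algebra.
From mathcomp Require Import all_classical all_reals all_analysis.
From mathcomp Require Import measurable_realfun.
From mathcomp Require Import ring lra zify.

Set Implicit Arguments.
Unset Strict Implicit.
Unset Printing Implicit Defensive.
Import Order.TTheory GRing.Theory Num.Theory.
Import numFieldNormedType.Exports.
Local Open Scope classical_set_scope.
Local Open Scope ring_scope.

(** Every [y_k] in [Q] is [\sum_i a_ki e_i] for a basis [e] of [Q].  Let [L] be
    the space of row vectors [z] with [z *m a = 0]; it has dimension at least
    [n - m], and at every point [t] it is orthogonal to [(y_k(t))_k].  Hence, for
    any [Z] assigning to a sign sequence [s] a vector of [L] with entries in
    [[-1, 1]],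

      [\sum_k |r_k(t) - y_k(t)| >= \sum_k r_k(t) Z(r(t))_k],

    and after integration the sum of the distances is at least the average over
    all sign sequences of the correlation [<s, Z(s)>]
    ([sum_dist_rademacher_fun]; the Rademacher functions are turned into
    independent signs by halving dyadic intervals, [sign_avg_le_integral]).

    A good [Z] is the endpoint of a random walk started at 0 and driven by the
    signs ([walk_exists]).  Step [k] adds plus or minus half of [P e_k], the sign
    being [s_k], where [P] is the orthogonal projector on those vectors of [L]
    that vanish at every coordinate already of absolute value at least 1/2.  Such
    frozen coordinates never move again and a step changes a coordinate by at most
    1/2, so the walk stays in the cube.  The steps are martingale increments: only
    step [k] contributes to the expectation of [s_k Z_k], and its contribution is
    [P_kk / 2], whereas it adds [|P e_k|^2 / 4 = P_kk / 4] to the expected square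
    norm.  Thus, with [D] the average correlation, the average of [|Z|^2] is
    [D / 2].  The projectors decrease along the walk, so [2 D] is at least the
    average trace of the last one, that is at least [n - m] minus the average number
    of frozen coordinates, and that number is at most [4 |Z|^2].  So
    [2 D >= n - m - 2 D], i.e. [D >= (n - m) / 4], which is at least
    [eps n / 4 >= eps^2 n / 4]. *)

(** * Orthogonal projectors on row spaces *)

Section OrthogonalProjector.
Context (R : realFieldType).

Lemma mulmx_tr_eq0 p n (A : 'M[R]_(p, n)) : A *m A^T = 0 -> A = 0.
Proof.
move=> A0; apply/matrixP => i j; rewrite mxE.
have /psumr_eq0P : \sum_k A i k ^+ 2 = 0.
  transitivity ((A *m A^T) i i); last by rewrite A0 mxE.
  rewrite mxE.
  by apply: eq_bigr => k _; rewrite mxE expr2.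
by move=> /(_ (fun k _ => sqr_ge0 _)) /(_ j isT) /eqP; rewrite sqrf_eq0 => /eqP.
Qed.

(** Over an ordered field, [x *m (B *m B^T) = 0] forces [x *m B] to be orthogonal to
    itself, hence 0. *)
Lemma gram_unitmx p n (B : 'M[R]_(p, n)) : row_free B -> B *m B^T \in unitmx.
Proof.
move=> fB; rewrite -row_free_unit -kermx_eq0; apply/eqP.
set K := kermx _; apply: (row_free_inj fB); rewrite mul0mx.
apply: mulmx_tr_eq0; rewrite trmx_mul mulmxA -[K *m B *m _]mulmxA.
by rewrite mulmx_ker mul0mx.
Qed.

Definition orthoproj p n (A : 'M[R]_(p, n)) : 'M[R]_n :=
  let B := row_base A in B^T *m invmx (B *m B^T) *m B.

Section Theory.
Context (p n : nat) (A : 'M[R]_(p, n)).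
Local Notation B := (row_base A).
Local Notation P := (orthoproj A).

Let BB : B *m B^T \in unitmx.
Proof. by rewrite gram_unitmx// row_base_free. Qed.

Lemma orthoproj_sym : P^T = P.
Proof.
rewrite /orthoproj; move: (row_base A) => C.
by rewrite !trmx_mul trmxK trmx_inv trmx_mul trmxK mulmxA.
Qed.

Lemma orthoproj_id q (v : 'M[R]_(q, n)) : (v <= A)%MS -> v *m P = v.
Proof.
rewrite -(eq_row_base A) => /submxP[w ->].
rewrite /orthoproj; move: BB w; move: (row_base A) => C CC w.
by rewrite !mulmxA -[w *m C *m _]mulmxA mulmxK.
Qed.

Lemma orthoproj_sub : (P <= A)%MS.
Proof. by rewrite /orthoproj (submx_trans (submxMl _ _))// eq_row_base. Qed.

Lemma orthoproj_idem : P *m P = P.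
Proof. exact/orthoproj_id/orthoproj_sub. Qed.

Lemma mxtrace_orthoproj : \tr P = (\rank A)%:R.
Proof. by rewrite /orthoproj mxtrace_mulC mulmxA mulmxV// mxtrace1. Qed.

End Theory.

Lemma projector_diag n (P : 'M[R]_n) j : P^T = P -> P *m P = P ->
  P j j = \sum_i P j i ^+ 2.
Proof.
move=> Ps PP; rewrite -[in LHS]PP mxE; apply: eq_bigr => i _.
by rewrite expr2 -[in X in _ * X]Ps mxE.
Qed.

(** The row of index [i] has square norm [P i i], which bounds [P i i ^+ 2]. *)
Lemma projector_entry n (P : 'M[R]_n) i j : P^T = P -> P *m P = P ->
  `|P i j| <= 1.
Proof.
move=> Ps PP.
have sq k : P i k ^+ 2 <= P i i.
  by rewrite (projector_diag i Ps PP) (bigD1 k)//= lerDl sumr_ge0// => l _;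
    exact: sqr_ge0.
have Pii1 : P i i <= 1.
  have := sq i; have [//|P1] := leP (P i i) 1; nra.
by rewrite -(@expr_le1 _ 2)// real_normK ?num_real// (le_trans (sq j)).
Qed.

(** The difference of nested projectors is again a symmetric idempotent, so its
    diagonal entries are sums of squares. *)
Lemma orthoproj_diag_mono p q n (A : 'M[R]_(p, n)) (A' : 'M[R]_(q, n)) j :
  (A' <= A)%MS -> orthoproj A' j j <= orthoproj A j j.
Proof.
move=> AA'; set P := orthoproj A; set P' := orthoproj A'.
have P'P : P' *m P = P' by apply: orthoproj_id; exact: submx_trans (orthoproj_sub _) AA'.
have PP' : P *m P' = P'.
  by apply: trmx_inj; rewrite trmx_mul !orthoproj_sym.
have Ds : (P - P')^T = P - P' by rewrite linearB/= !orthoproj_sym.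
have DD : (P - P') *m (P - P') = P - P'.
  by rewrite mulmxBl !mulmxBr P'P PP' !orthoproj_idem subrr subr0.
have := projector_diag j Ds DD; rewrite !mxE => h.
by rewrite -subr_ge0 h sumr_ge0// => i _; exact: sqr_ge0.
Qed.

End OrthogonalProjector.

(** * Averages over sign sequences *)

Section SignAverage.
Context (R : realFieldType).

(** The average of [G] over the [2 ^ r] boolean sequences of length [r], by
    conditioning on the first one: this recursion is followed both by the random
    walk and by the halving of dyadic intervals. *)
Fixpoint sign_avg (r : nat) (G : seq bool -> R) : R :=
  if r is r'.+1 then
    (sign_avg r' (fun s => G (false :: s)) +
     sign_avg r' (fun s => G (true :: s))) / 2
  else G [::].

Lemma eq_sign_avg r G H : G =1 H -> sign_avg r G = sign_avg r H.
Proof.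
elim: r G H => [|r IH] G H GH /=; first exact: GH.
by congr ((_ + _) / 2); apply: IH => s; exact: GH.
Qed.

Lemma sign_avg_cst r c : sign_avg r (fun=> c) = c.
Proof. by elim: r => //= r ->; rewrite mulrDl -splitr. Qed.

Lemma sign_avgD r G H :
  sign_avg r (fun s => G s + H s) = sign_avg r G + sign_avg r H.
Proof. by elim: r G H => //= r IH G H; rewrite !IH; ring. Qed.

Lemma sign_avgZ r a G : sign_avg r (fun s => a * G s) = a * sign_avg r G.
Proof. by elim: r G => //= r IH G; rewrite !IH; ring. Qed.

Lemma le_sign_avg r G H : (forall s, G s <= H s) -> sign_avg r G <= sign_avg r H.
Proof.
elim: r G H => [|r IH] G H GH /=; first exact: GH.
by rewrite ler_pM2r ?invr_gt0 ?ltr0n// lerD// IH.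
Qed.

End SignAverage.

(** * The random walk *)

Section RandomWalk.
Context (R : realFieldType) (n m : nat) (a : 'M[R]_(n, m)).
Implicit Types z v : 'rV[R]_n.

Definition frozen z : {set 'I_n} := [set i | 2^-1 <= `|z 0 i|].

(** The vectors [v] with [v *m a = 0] that vanish on [frozen z]: the extra columns
    select the frozen coordinates, so that there are [m + #|frozen z|] equations. *)
Definition moves z : 'M[R]_n :=
  kermx (row_mx a (\matrix_(i < n, j < #|frozen z|) (i == enum_val j)%:R)).

Definition move_proj z : 'M[R]_n := orthoproj (moves z).

Lemma sub_movesP p z (v : 'M[R]_(p, n)) :
  reflect (v *m a = 0 /\ forall k i, i \in frozen z -> v k i = 0)
          (v <= moves z)%MS.
Proof.
apply: (iffP sub_kermxP); rewrite mul_mx_row.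
  move=> /eqP; rewrite row_mx_eq0 => /andP[/eqP va /eqP vF]; split => // k i iF.
  have := congr1 (fun M : 'M[R]_(p, _) => M k (enum_rank_in iF i)) vF.
  rewrite !mxE (bigD1 i)//= !mxE enum_rankK_in// eqxx mulr1 big1 ?addr0// => j ji.
  by rewrite mxE enum_rankK_in// (negPf ji) mulr0.
move=> [va vF]; apply/eqP; rewrite row_mx_eq0 va eqxx/=; apply/eqP/matrixP => k j.
rewrite !mxE big1// => i _; rewrite mxE; case: eqP => [->|_]; last by rewrite mulr0.
by rewrite vF ?mul0r// enum_valP.
Qed.

Lemma moves_mono z z' :
  {in frozen z, forall i, z' 0 i = z 0 i} -> (moves z' <= moves z)%MS.
Proof.
move=> zz'; have /sub_movesP[Ma MF] := submx_refl (moves z').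
apply/sub_movesP; split => // k i iF; apply: MF.
by move: (iF); rewrite !inE zz'.
Qed.

Lemma rank_moves z : (n <= \rank (moves z) + m + #|frozen z|)%N.
Proof.
rewrite mxrank_ker -addnA; set r := \rank _.
by have : (r <= m + #|frozen z|)%N := rank_leq_col _; lia.
Qed.

Definition sqnorm z : R := \sum_i z 0 i ^+ 2.

Lemma card_frozen z : #|frozen z|%:R <= 4 * sqnorm z.
Proof.
rewrite /sqnorm -sum1_card natr_sum mulr_sumr big_mkcond/=.
apply: ler_sum => i _; case: ifPn; rewrite inE; last first.
  by move=> _; rewrite mulr_ge0// sqr_ge0.
rewrite -[z 0 i ^+ 2]real_normK ?num_real//; nra.
Qed.

Definition sgn_of (b : bool) : R := (-1) ^+ b.

(** [s] lists only the signs of the coordinates from [k] on. *)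
Definition tail_correlation (k : nat) (s : seq bool) z : R :=
  \sum_(i < n | (k <= i)%N) sgn_of (nth false s (i - k)) * z 0 i.

(** An unfrozen coordinate is below 1/2 and moves by at most 1/2. *)
Lemma walk_step z (k : 'I_n) : z *m a = 0 -> (forall i, `|z 0 i| <= 1) ->
  let v := 2^-1 *: row k (move_proj z) in
  forall b, let z' := z + sgn_of b *: v in
  [/\ z' *m a = 0, forall i, `|z' 0 i| <= 1 &
      {in frozen z, forall i, z' 0 i = z 0 i}].
Proof.
move=> za z1 v b z'.
have /sub_movesP[Pa PF] : (move_proj z <= moves z)%MS by exact: orthoproj_sub.
have vE i : v 0 i = 2^-1 * move_proj z k i by rewrite /v 2!mxE.
have vF i : i \in frozen z -> v 0 i = 0.
  by move=> iF; rewrite vE PF// mulr0.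
have z'F : {in frozen z, forall i, z' 0 i = z 0 i}.
  by move=> i iF; rewrite /z' 2!mxE vF// mulr0 addr0.
split => //.
  by rewrite /z' mulmxDl za -!scalemxAl -row_mul Pa row0 !scaler0 addr0.
move=> i; have [iF|] := boolP (i \in frozen z); first by rewrite z'F.
rewrite inE -ltNge => zi; rewrite /z' mxE (le_trans (ler_normD _ _))//.
rewrite [leRHS](splitr 1) mul1r lerD ?(ltW zi)//.
rewrite mxE vE !normrM /sgn_of normrX normrN1 expr1n mul1r.
rewrite (@ger0_norm _ 2^-1) ?invr_ge0// -[leRHS]mulr1.
rewrite ler_wpM2l ?invr_ge0// projector_entry//;
  [exact: orthoproj_sym|exact: orthoproj_idem].
Qed.

(** What is remembered of the endpoint [Z] of a walk that is at [z] before step [k]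
    and has [r] steps left.  The last three clauses are the martingale property, the
    balance between square norm and correlation (each step [P e_k / 2] brings
    [P_kk / 4] to the first and [P_kk / 2] to the second), and the comparison of the
    diagonal entries [P_kk] met along the walk with those of the final projector. *)
Definition walk_spec r k z (Z : seq bool -> 'rV[R]_n) :=
  [/\ forall s, Z s *m a = 0,
      forall s i, `|Z s 0 i| <= 1,
      forall s, {in frozen z, forall i, Z s 0 i = z 0 i} &
   [/\ forall i, sign_avg r (fun s => Z s 0 i) = z 0 i,
      sign_avg r (fun s => sqnorm (Z s)) =
        sqnorm z + 2^-1 * sign_avg r (fun s => tail_correlation k s (Z s)) &
      sign_avg r (fun s => \sum_(i < n | (k <= i)%N) move_proj (Z s) i i)
        <= 2 * sign_avg r (fun s => tail_correlation k s (Z s))]].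

(** By induction on the number of steps left, splitting on the first sign; the cross
    terms of the two branches cancel in the average. *)
Lemma walk_exists r k z : (k + r)%N = n -> z *m a = 0 ->
  (forall i, `|z 0 i| <= 1) -> exists Z, walk_spec r k z Z.
Proof.
elim: r k z => [|r IH] k z krn za z1.
  have nok (F : 'I_n -> R) : \sum_(i < n | (k <= i)%N) F i = 0.
    by rewrite big1// => i; have := ltn_ord i; lia.
  by exists (fun=> z); do 2?split => //=;
    rewrite /tail_correlation !nok ?mulr0 ?addr0.
have kn : (k < n)%N by lia.
pose k' := Ordinal kn; pose v := 2^-1 *: row k' (move_proj z).
have st := walk_step k' za z1.
have IHb b : exists Z, walk_spec r k.+1 (z + sgn_of b *: v) Z.
  by have [? ? _] := st b; apply: IH => //; lia.
have [[Z0 [Z0a Z01 Z0F [Z0m Z0q Z0d]]] [Z1 [Z1a Z11 Z1F [Z1m Z1q Z1d]]]] :=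
  (IHb false, IHb true).
have tl (F : 'I_n -> R) : \sum_(i < n | (k <= i)%N) F i =
    F k' + \sum_(i < n | (k < i)%N) F i.
  rewrite (bigD1 k')//=; congr (_ + _); apply: eq_bigl => i.
  by rewrite ltn_neqAle andbC eq_sym.
have td b s w : tail_correlation k (b :: s) w =
    sgn_of b * w 0 k' + tail_correlation k.+1 s w.
  rewrite /tail_correlation tl/= subnn; congr (_ + _); apply: eq_bigr => i ki.
  by rewrite -(subnSK ki).
(* The first sign selects the branch; averages over [r.+1] signs never read the
   value at the empty sequence. *)
pose Z s := if s is b :: s' then (if b then Z1 s' else Z0 s') else z.
have fz b : {subset frozen z <= frozen (z + sgn_of b *: v)}.
  by have [_ _ h] := st b; move=> i iF; move: (iF); rewrite !inE h.
have ZF s : {in frozen z, forall i, Z s 0 i = z 0 i}.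
  move=> i iF; case: s => [|[] s]//=.
    by rewrite Z1F ?fz//; have [_ _ ->] := st true.
  by rewrite Z0F ?fz//; have [_ _ ->] := st false.
have Za s : Z s *m a = 0 by case: s => [|[] s]; rewrite /= ?Z0a ?Z1a.
have Z1' s i : `|Z s 0 i| <= 1 by case: s => [|[] s]; rewrite /= ?Z01 ?Z11.
have vE i : v 0 i = 2^-1 * move_proj z k' i by rewrite /v 2!mxE.
have mvE b i : (z + sgn_of b *: v) 0 i =
    z 0 i + sgn_of b * (2^-1 * move_proj z k' i).
  by rewrite mxE [X in _ + X]mxE vE.
have vv : sqnorm v = 4^-1 * move_proj z k' k'.
  rewrite (projector_diag k' (orthoproj_sym _) (orthoproj_idem _)).
  rewrite /sqnorm mulr_sumr; apply: eq_bigr => i _.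
  by rewrite vE; field.
have sqD b : sqnorm (z + sgn_of b *: v) =
    sqnorm z + sqnorm v + 2 * sgn_of b * \sum_i z 0 i * v 0 i.
  rewrite /sqnorm mulr_sumr -!big_split/=; apply: eq_bigr => i _.
  by rewrite mxE [X in (_ + X) ^+ 2]mxE; case: b; rewrite /sgn_of ?expr0 ?expr1; ring.
have dotE : sign_avg r.+1 (fun s => tail_correlation k s (Z s)) =
    2^-1 * move_proj z k' k' +
    (sign_avg r (fun s => tail_correlation k.+1 s (Z0 s)) +
      sign_avg r (fun s => tail_correlation k.+1 s (Z1 s))) / 2.
  rewrite /=; under eq_sign_avg do rewrite td.
  under [in X in _ + X]eq_sign_avg do rewrite td.
  rewrite !sign_avgD !sign_avgZ Z0m Z1m !mvE.
  by rewrite /sgn_of expr0 expr1; field.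
exists Z; split; [exact: Za|exact: Z1'|exact: ZF|split].
- by move=> i; rewrite /= Z0m Z1m !mvE /sgn_of; field.
- by rewrite dotE /= Z0q Z1q !sqD vv /sgn_of expr0 expr1; field.
- rewrite dotE.
  (* Replacing the current projector by a final one can only decrease the
     diagonal entry [k'], as the moves shrink along the walk. *)
  have trE b (Zb : seq bool -> 'rV[R]_n) : (forall s, Zb s = Z (b :: s)) ->
      sign_avg r (fun s => \sum_(i < n | (k <= i)%N) move_proj (Zb s) i i) <=
      move_proj z k' k' +
      sign_avg r (fun s => \sum_(i < n | (k < i)%N) move_proj (Zb s) i i).
    move=> ZbE; rewrite -[X in X + _](sign_avg_cst r) -sign_avgD.
    apply: le_sign_avg => s; rewrite tl lerD2r ZbE.
    by apply: orthoproj_diag_mono; apply: moves_mono => i; exact: ZF.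
  have := trE false Z0 (fun=> erefl); have := trE true Z1 (fun=> erefl).
  move=> /=; lra.
Qed.

(** With [D] the average correlation of the walk from 0, the trace of the final
    projector is at least [n - m - 4 |Z|^2], so [2 D >= n - m - 4 (D / 2)]. *)
Lemma correlated_cube_vectors : exists Z : seq bool -> 'rV[R]_n,
  [/\ forall s, Z s *m a = 0, forall s i, `|Z s 0 i| <= 1 &
    (n%:R - m%:R) / 4 <=
      sign_avg n (fun s => \sum_(i < n) sgn_of (nth false s i) * Z s 0 i)].
Proof.
have [||//|Z [Za Z1 _ [_ Zq Zd]]] := @walk_exists n 0 0.
- by [].
- by rewrite mul0mx.
- by move=> i; rewrite mxE normr0.
exists Z; split => //.
have -> : sign_avg n (fun s => \sum_(i < n) sgn_of (nth false s i) * Z s 0 i) =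
    sign_avg n (fun s => tail_correlation 0 s (Z s)).
  by apply: eq_sign_avg => s; apply: eq_bigr => i _; rewrite subn0.
have q0 : sqnorm 0 = 0.
  by rewrite /sqnorm big1// => i _; rewrite mxE expr0n.
have : sign_avg n (fun s => n%:R - m%:R + - 4 * sqnorm (Z s)) <=
    sign_avg n (fun s => \sum_(i < n | (0 <= i)%N) move_proj (Z s) i i).
  apply: le_sign_avg => s.
  have -> : \sum_(i < n | (0 <= i)%N) move_proj (Z s) i i = (\rank (moves (Z s)))%:R.
    exact: mxtrace_orthoproj.
  have := rank_moves (Z s); rewrite -(ler_nat R) !natrD.
  have := card_frozen (Z s); lra.
move: Zq Zd; rewrite q0 add0r sign_avgD sign_avg_cst sign_avgZ; lra.
Qed.

End RandomWalk.

(** * From sign sequences to the unit interval *)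

Section DyadicIntegral.
Context (R : realType).
Local Notation mu := (lebesgue01 R).

(** The binary digits of [t] of indices [k.+1] to [k + r]. *)
Definition digits (k r : nat) (t : R) : seq bool :=
  [seq odd (Num.truncn (2 ^+ j * t)) | j <- iota k.+1 r].

Definition dyadic (k i : nat) : set R := [set` `[i%:R / 2 ^+ k, i.+1%:R / 2 ^+ k[%R].

Lemma dyadic_truncn k i t : dyadic k i t -> Num.truncn (2 ^+ k * t) = i.
Proof.
have k0 : 0 < 2 ^+ k :> R by rewrite exprn_gt0.
rewrite /dyadic/= in_itv/= ler_pdivrMr// ltr_pdivlMr// (mulrC t).
exact: truncn_def.
Qed.

Lemma dyadic_split k i : dyadic k i = dyadic k.+1 i.*2 `|` dyadic k.+1 i.*2.+1.
Proof.
have k0 : 0 < 2 ^+ k :> R by rewrite exprn_gt0.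
have e (j : nat) : j.*2%:R / 2 ^+ k.+1 = j%:R / 2 ^+ k :> R.
  by rewrite -mul2n natrM exprS -mulf_div divff ?mul1r// pnatr_eq0.
rewrite /dyadic -doubleS !e.
have l1 : i%:R / 2 ^+ k <= i.*2.+1%:R / 2 ^+ k.+1 :> R.
  by rewrite -e ler_pM2r ?invr_gt0 ?exprn_gt0// ler_nat.
have l2 : i.*2.+1%:R / 2 ^+ k.+1 <= i.+1%:R / 2 ^+ k :> R.
  by rewrite -e ler_pM2r ?invr_gt0 ?exprn_gt0// ler_nat doubleS.
apply/seteqP; split => t /=; rewrite !in_itv/=.
  move=> /andP[a b]; have [c|c] := ltP t (i.*2.+1%:R / 2 ^+ k.+1).
    by left; rewrite a.
  by right.
move=> [/andP[a b]|/andP[a b]]; first by rewrite a (lt_le_trans b).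
by rewrite (le_trans l1 a).
Qed.

Lemma lebesgue01_dyadic k i : (i < 2 ^ k)%N -> mu (dyadic k i) = (2 ^- k)%:E.
Proof.
move=> ik; have k0 : 0 < 2 ^+ k :> R by rewrite exprn_gt0.
have lt1 : i%:R / 2 ^+ k < i.+1%:R / 2 ^+ k :> R.
  by rewrite ltr_pM2r ?invr_gt0// ltr_nat.
rewrite /lebesgue01 /mrestr setIidl.
  rewrite lebesgue_measure_itv/= lte_fin lt1 -EFinD -mulrBl -natrB// subSnn mul1r//.
move=> t; rewrite /dyadic/= !in_itv/= => /andP[a b].
rewrite (le_trans _ a) ?mulr_ge0 ?invr_ge0 ?(ltW k0)//=.
by rewrite (le_trans (ltW b))// ler_pdivrMr// mul1r -natrX ler_nat.
Qed.

Lemma measurable_dyadic k i : measurable (dyadic k i).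
Proof. exact: measurable_itv. Qed.

(** By halving: on the two halves of a dyadic interval of level [k] the digit
    of index [k.+1] is constant, equal to 0 on the left and 1 on the right. *)
Lemma sign_avg_le_integral (f : R -> \bar R) (r k i : nat) (G : seq bool -> R) :
  measurable_fun setT f -> (forall t, (0 <= f t)%E) -> (i < 2 ^ k)%N ->
  (forall t, dyadic k i t -> ((G (digits k r t))%:E <= f t)%E) ->
  ((2 ^- k * sign_avg r G)%:E <= \int[mu]_(t in dyadic k i) f t)%E.
Proof.
move=> mf f0; elim: r k i G => [|r IH] k i G ik Gf.
  (* Integrals of nonnegative functions are compared, so a negative constant is
     bounded separately. *)
  have [G0|G0] := leP 0 (G [::]); last first.
    apply: (@le_trans _ _ 0%E); last exact: integral_ge0.
    by rewrite lee_fin /= mulr_ge0_le0 ?(ltW G0)// invr_ge0 exprn_ge0.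
  rewrite /= mulrC EFinM -(lebesgue01_dyadic ik) -integral_cst;
    last exact: measurable_dyadic.
  apply: ge0_le_integral => //=; first exact: measurable_dyadic.
  - exact: measurable_funS mf.
rewrite dyadic_split ge0_integral_setU//; first last.
- apply/disj_setPS => t /= [/dyadic_truncn h /dyadic_truncn]; rewrite h.
  by move=> /eqP; rewrite -[_ == _]/(i.*2 == i.*2.+1) eqn_leq ltnn andbF.
- exact: measurable_funS mf.
- exact: measurable_dyadic.
- exact: measurable_dyadic.
have -> : 2 ^- k * sign_avg r.+1 G =
    2 ^- k.+1 * sign_avg r (fun s => G (false :: s)) +
    2 ^- k.+1 * sign_avg r (fun s => G (true :: s)).
  rewrite /= exprS; field; exact: expf_neq0.
have ik2 : (i.*2.+1 < 2 ^ k.+1)%N by rewrite expnS; lia.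
have dig t j : dyadic k.+1 j t -> digits k r.+1 t = odd j :: digits k.+1 r t.
  by move=> /dyadic_truncn tj; rewrite /digits/= tj.
rewrite EFinD; apply: leeD; apply: IH => //.
- exact: ltnW.
- move=> t tj; have := Gf t; rewrite (dig _ _ tj) odd_double; apply.
  by rewrite dyadic_split; left.
- move=> t tj; have := Gf t; rewrite (dig _ _ tj) oddS odd_double; apply.
  by rewrite dyadic_split; right.
Qed.

Lemma sign_avg_le_integralT (f : R -> \bar R) n (G : seq bool -> R) :
  measurable_fun setT f -> (forall t, (0 <= f t)%E) ->
  (forall t, ((G (digits 0 n t))%:E <= f t)%E) ->
  ((sign_avg n G)%:E <= \int[mu]_t f t)%E.
Proof.
move=> mf f0 Gf; have := @sign_avg_le_integral f n 0 0 G mf f0 isT (fun t _ => Gf t).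
rewrite expr0 invr1 mul1r => /le_trans; apply.
by apply: ge0_subset_integral => //; exact: measurable_dyadic.
Qed.

End DyadicIntegral.

Lemma measurable_abse_Lfun d (T : measurableType d) (R : realType)
    (mu : {measure set T -> \bar R}) (p : \bar R) (p1 : (1 <= p)%E)
    (g : LfunType mu p1) :
  measurable_fun [set: T] (fun t => `|(EFin \o g) t|%E).
Proof.
by apply: (measurableT_comp (@abse_measurable R setT)); exact/measurable_EFinP.
Qed.

(** * Distances of the Rademacher functions to a subspace *)

Section Rigidity.
Context (R : realType).
Local Notation mu := (lebesgue01 R).
Local Notation L1fun := (LfunType mu (@lexx _ (\bar R) 1%E)).

(** At each [t], the vectors [Z s] annihilate [(\sum_i a k i * e i t)_k] and have
    entries of absolute value at most 1, so [\sum_k |h k t|] is at least the correlation of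
    [Z s] with the Rademacher signs [s] at [t]. *)
Lemma sum_dist_rademacher_fun n m (a : 'M[R]_(n, m)) (e : 'I_m -> L1fun)
    (h : 'I_n -> L1fun) :
  (forall k t, h k t = rademacher_fun k.+1 t - \sum_i a k i * e i t) ->
  (n%:R - m%:R) / 4 <= \sum_(k < n) fine 'N[mu]_1[EFin \o h k].
Proof.
move=> hE; have [Z [Za Z1 Zd]] := correlated_cube_vectors a.
rewrite -lee_fin -sumEFin.
under eq_bigr do rewrite finite_norm_fine Lnorm1.
have mh k := measurable_abse_Lfun (h k).
rewrite -ge0_integral_sum//.
apply: (@le_trans _ _ (sign_avg n
    (fun s => \sum_(i < n) sgn_of R (nth false s i) * Z s 0 i))%:E).
  by rewrite lee_fin.
apply: sign_avg_le_integralT.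
- exact: emeasurable_sum.
- by move=> t; apply: sume_ge0.
move=> t; rewrite sumEFin lee_fin; set s := digits 0 n t.
have rad (k : 'I_n) : sgn_of R (nth false s k) = rademacher_fun k.+1 t.
  by rewrite /sgn_of /s /digits (nth_map 0%N) ?size_iota// nth_iota// add1n.
have -> : \sum_(k < n) sgn_of R (nth false s k) * Z s 0 k =
    \sum_(k < n) h k t * Z s 0 k.
  under [RHS]eq_bigr do rewrite hE mulrBl.
  rewrite sumrB -[LHS]subr0; congr (_ - _);
    first by apply: eq_bigr => k _; rewrite rad.
  under eq_bigr do rewrite mulr_suml.
  rewrite exchange_big big1//= => i _.
  have := congr1 (fun M : 'M[R]_(1, m) => M 0 i) (Za s); rewrite !mxE => Zi.
  transitivity (e i t * \sum_j Z s 0 j * a j i); last by rewrite Zi mulr0.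
  by rewrite mulr_sumr; apply: eq_bigr => k _; ring.
apply: ler_sum => k _; apply: (le_trans (ler_norm _)).
by rewrite normrM ler_piMr.
Qed.

Lemma sum_dist_rademacher n m (Q : {pred L1space mu}) (y : 'I_n -> L1space mu) :
  subspace_of_dim Q m -> (forall k, y k \in Q) ->
  (n%:R - m%:R) / 4 <= \sum_(k < n) `|rademacher R k.+1 - y k|.
Proof.
move=> [_ [e [_ _ span]]] yQ.
have /choice[a ya] : forall k, exists a : 'I_m -> R, y k = \sum_i a i *: e i.
  by move=> k; exact: span.
pose f i : L1fun := repr (e i).
pose rf k : L1fun := Lfun_Sub (lexx 1%E) (rademacher_Lfun R k).
pose h (k : 'I_n) : L1fun := rf k.+1 + \sum_i (- a k i) *: f i.
have pi_sum (I : finType) (g : I -> L1fun) :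
    (\pi_(L1space mu) (\sum_i g i) = \sum_i \pi_(L1space mu) (g i))%qT.
  exact: (big_morph _ (@L1space_piD _ _ _ mu) (@L1space_pi0 _ _ _ mu)).
have hn (k : 'I_n) : `|rademacher R k.+1 - y k| = fine 'N[mu]_1[EFin \o h k].
  rewrite -L1norm_pi; congr (L1norm _).
  rewrite L1space_piD pi_sum ya -sumrN; congr (_ + _); apply: eq_bigr => i _.
  by rewrite -L1space_piZ reprK -scaleNr.
under eq_bigr do rewrite hn.
apply: (@sum_dist_rademacher_fun n m (\matrix_(k, i) a k i) f) => k t.
have sumE (g : 'I_m -> L1fun) : (\sum_i g i : L1fun) t = \sum_i g i t.
  by apply: (big_morph (fun u : L1fun => u t)).
transitivity (rf k.+1 t + (\sum_i (- a k i) *: f i : L1fun) t) => //.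
rewrite sumE -sumrN; congr (_ + _); apply: eq_bigr => i _.
by rewrite mxE -mulNr.
Qed.

Lemma dist_to_set_approx (X : normedModType R) (Q : set X) (x : X) (d : R) :
  Q !=set0 -> 0 < d -> exists2 y, Q y & `|x - y| < dist_to_set x Q + d.
Proof.
move=> [q Qq] d0.
have [|_ [y Qy <-] yd] := @inf_adherent R [set `|x - y| | y in Q] d d0.
  split; first by exists `|x - q|; exists q.
  by exists 0 => _ [y _ <-]; exact: normr_ge0.
by exists y.
Qed.

Lemma sum_dist_to_set_rademacher n m (Q : {pred L1space mu}) :
  subspace_of_dim Q m ->
  (n%:R - m%:R) / 4 <= \sum_(1 <= k < n.+1) dist_to_set (rademacher R k) [set` Q].
Proof.
move=> Qm; rewrite big_add1/= big_mkord; apply/ler_addgt0Pr => d d0.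
(* [n] may be 0 here, hence the division by [n.+1]. *)
have d'0 : 0 < d / n.+1%:R by rewrite divr_gt0.
have Q0 : [set` Q] !=set0 by exists 0; case: Qm => -[].
have /choice[y yP] : forall k : 'I_n, exists y, y \in Q /\
    `|rademacher R k.+1 - y| <
      dist_to_set (rademacher R k.+1) [set` Q] + d / n.+1%:R.
  by move=> k; have [y] := dist_to_set_approx (rademacher R k.+1) Q0 d'0; exists y.
apply: (le_trans (@sum_dist_rademacher n m Q y Qm _));
  first by move=> k; case: (yP k).
apply: (@le_trans _ _ (\sum_(k < n)
    (dist_to_set (rademacher R k.+1) [set` Q] + d / n.+1%:R))).
  by apply: ler_sum => k _; apply: ltW; case: (yP k).
rewrite big_split/= lerD2l sumr_const card_ord -[leLHS]mulr_natr mulrAC.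
by rewrite ler_pdivrMr// ler_pM2l// ler_nat.
Qed.

End Rigidity.

Theorem mainTheorem5 (R : realType) :
  exists c : R, 0 < c /\
    forall (eps : R) (n m : nat) (Q : {pred L1space (lebesgue01 R)}),
      0 < eps -> eps < 1 -> (0 < n)%N ->
      subspace_of_dim Q m ->
      m%:R <= (1 - eps) * n%:R ->
      n%:R^-1 * \sum_(1 <= k < n.+1) dist_to_set (rademacher R k) [set` Q]
        >= c * eps ^+ 2.
Proof.
exists 4^-1; split=> // eps n m Q e0 e1 n0 Qm mn.
have n0' : 0 < n%:R :> R by rewrite ltr0n.
rewrite ler_pdivlMl//; apply: le_trans (sum_dist_to_set_rademacher n Qm).
have : eps ^+ 2 * n%:R <= eps * n%:R.
  by rewrite ler_pM2r// expr2 ler_piMl// ltW.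
lra.
Qed.
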